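(* In the unidimensional platform game of the context, let the power rule be $\rho_{\rho_m}$ with majority premium $\rho_m\in[0,\bar\rho)$, and let $\underline x(\rho_m)<\bar x(\rho_m)$ be the corresponding equilibrium platforms. Then $D(\rho_m)=\bar x(\rho_m)-\underline x(\rho_m)$ is weakly decreasing in $\rho_m$. If, for some type $m$, $$\sum_{i<m}s_i<\frac12<\sum_{i\le m}s_i,$$ then $D(\rho_m)$ is strictly decreasing in $\rho_m$ and $$\underline x(\rho_m)\to x_m,\qquad\bar x(\rho_m)\to x_m,\qquad D(\rho_m)\to0\qquad\text{as }\rho_m\to\bar\rho^-.$$
   Context: There are $N\ge2$ voter types with bliss points $x_1<\cdots<x_N$ in $\mathbb R$ and shares $s_i>0$, $\sum_is_i=1$. Parties $A,B$ simultaneously choose platforms in $[x_1,x_N]$. Let $\Delta_i(x_A,x_B)=(x_B-x_i)^2-(x_A-x_i)^2$. A common shock $\epsilon$ is uniform on $[-\phi,\phi]$ with $\phi>\max_{a,b\in[x_1,x_N],\,i}|\Delta_i(a,b)|$. Vote shares are $S_A(\epsilon)=\sum_is_i\mathbf 1\{\Delta_i\ge\epsilon\}$, $S_B=1-S_A$. For fixed $\bar\rho>0$ and $\rho_m\in[0,\bar\rho)$ the power rule is $\rho_{\rho_m}(s)=(\bar\rho-\rho_m)s$ for $s<\frac12$, $\rho_{\rho_m}(\frac12)=\frac{\bar\rho}2$, and $\rho_{\rho_m}(s)=(\bar\rho-\rho_m)s+\rho_m$ for $s>\frac12$. The function $U:[0,\bar\rho]\to\mathbb R$ is fixed, continuous,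 strictly increasing and strictly concave, with $U(\bar\rho)-U(0)=1$; $\nu=U\circ\rho_{\rho_m}$ and payoffs are $V_p=\mathbb E_\epsilon[\nu(S_p(\epsilon))]$. Equilibrium facts: with $\underline s_i=\sum_{j\le i}s_j$, $\bar s_i=\sum_{j\ge i}s_j$, $\underline s_0=\bar s_{N+1}=0$, the pure-strategy Nash equilibria are exactly the two assignments of the platforms $\underline x(\rho_m)=\sum_i[\nu(\underline s_i)-\nu(\underline s_{i-1})]x_i$ and $\bar x(\rho_m)=\sum_i[\nu(\bar s_i)-\nu(\bar s_{i+1})]x_i$ to the two parties, and $\underline x(\rho_m)<\bar x(\rho_m)$. *)

(* Defs.v *)
From HB Require Import structures.
From mathcomp Require Import all_boot all_order all_algebra.
From mathcomp Require Import all_classical all_reals all_analysis.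

Set Implicit Arguments.
Unset Strict Implicit.
Unset Printing Implicit Defensive.

Import Order.TTheory GRing.Theory Num.Theory.
Import numFieldNormedType.Exports.

Local Open Scope classical_set_scope.
Local Open Scope ring_scope.

(* Utility advantage of platform [a] over platform [b] for bliss point [z]. *)
Definition utility_gap (R : realType) (z a b : R) : R :=
  (b - z) ^+ 2 - (a - z) ^+ 2.

Definition power_rule (R : realType) (rhobar rm s : R) : R :=
  if s < 2^-1 then (rhobar - rm) * s
  else if s == 2^-1 then rhobar / 2
  else (rhobar - rm) * s + rm.

(* There are N = n.+2 >= 2 voter types, indexed from ord0 to ord_max.
   [utility] is a total function of which only the values on [0, rhobar]
   are constrained and used. The majority premium is not part of the game. *)
Record platform_game (R : realType) (n : nat) := PlatformGame {
  bliss : 'I_n.+2 -> R ;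
  share : 'I_n.+2 -> R ;
  phi : R ;
  rhobar : R ;
  utility : R -> R ;
  bliss_lt : forall i j : 'I_n.+2, (i < j)%N -> bliss i < bliss j ;
  share_gt0 : forall i, 0 < share i ;
  share_sum1 : \sum_i share i = 1 ;
  phi_gt_gap : forall i a b,
    a \in `[bliss ord0, bliss ord_max] -> b \in `[bliss ord0, bliss ord_max] ->
    `|utility_gap (bliss i) a b| < phi ;
  rhobar_gt0 : 0 < rhobar ;
  utility_continuous : {within `[0, rhobar], continuous utility} ;
  utility_increasing : forall u v,
    u \in `[0, rhobar] -> v \in `[0, rhobar] -> u < v -> utility u < utility v ;
  utility_strictly_concave : forall u v t,
    u \in `[0, rhobar] -> v \in `[0, rhobar] -> u != v -> 0 < t < 1 ->
    t * utility u + (1 - t) * utility v < utility (t * u + (1 - t) * v) ;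
  utility_normalized : utility rhobar - utility 0 = 1
}.

Section game.
Context (R : realType) (n : nat) (G : platform_game R n).

Definition platforms : interval R := `[bliss G ord0, bliss G ord_max].

Lemma shock_itv : - phi G < phi G.
Proof.
have x1N : bliss G ord0 \in `[bliss G ord0, bliss G ord_max].
  by rewrite in_itv /= lexx ltW// bliss_lt.
have := @phi_gt_gap _ _ G ord0 _ _ x1N x1N.
by rewrite /utility_gap subrr normr0 => phi0; rewrite gtrN.
Qed.

Definition shock_law : probability _ R := uniform_prob shock_itv.

Definition vote_shareA (a b eps : R) : R :=
  \sum_i share G i * (eps <= utility_gap (bliss G i) a b)%R%:R.

Definition vote_shareB (a b eps : R) : R := 1 - vote_shareA a b eps.

Definition share_utility (rm s : R) : R :=
  utility G (power_rule (rhobar G) rm s).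

Definition payoffA (rm a b : R) : \bar R :=
  'E_shock_law[fun eps => share_utility rm (vote_shareA a b eps)].

Definition payoffB (rm a b : R) : \bar R :=
  'E_shock_law[fun eps => share_utility rm (vote_shareB a b eps)].

(* [a] is the platform of party A and [b] the platform of party B. *)
Definition nash_equilibrium (rm a b : R) : Prop :=
  [/\ a \in platforms, b \in platforms,
      forall a', a' \in platforms -> (payoffA rm a' b <= payoffA rm a b)%E
    & forall b', b' \in platforms -> (payoffB rm a b' <= payoffB rm a b)%E].

(* Ordered pairs of equilibrium platforms: since the two assignments of a pair
   of platforms to the parties are equilibria together, it suffices to give the
   lower platform to party A. *)
Definition equilibrium_platforms (rm xlo xhi : R) : Prop :=
  xlo < xhi /\ nash_equilibrium rm xlo xhi.

End game.

(* Main.v *)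
Require Import Defs.
From mathcomp Require Import all_boot all_order all_algebra.
From mathcomp Require Import all_classical all_reals all_analysis.
From mathcomp Require Import ring lra.

Set Implicit Arguments.
Unset Strict Implicit.
Unset Printing Implicit Defensive.

Import Order.TTheory GRing.Theory Num.Theory.
Import numFieldNormedType.Exports.

Local Open Scope classical_set_scope.
Local Open Scope ring_scope.

(* Against an opponent located to its right, the expected payoff of a party is,
   by linearity of the uniform law, an affine function of a weighted sum of
   utility gaps, hence of [- (x - L) ^ 2] with [L] the weighted mean of the
   bliss points; so in an equilibrium the left party sits at [L], and
   symmetrically for the right one. Summation by parts turns [D] into
   [\sum_k (z_{k+1} - z_k) (nu c_k + nu (1 - c_k) - nu 0 - nu 1)], where [c_k]
   is the cumulative share. The two powers arising at [c_k] and [1 - c_k] sum to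
   [rhobar] and move apart as the premium grows, so strict concavity of the
   utility makes every term decrease, unless [c_k = 1/2]. In the limit each of
   the two powers is [0] or [rhobar], and all the weight goes to the median
   type. *)

(** * Initial segments, summation by parts and weighted means *)

Lemma downward_closed_ltn (N : nat) (P : pred 'I_N) :
  (forall i j : 'I_N, (i <= j)%N -> P j -> P i) ->
  exists2 k, (k <= N)%N & forall i, P i = (i < k)%N.
Proof.
(* The bound is one past the largest index satisfying [P]; the empty maximum [0] covers an empty
   [P]. *)
move=> dP; exists (\max_(i | P i) i.+1)%N; first by apply/bigmax_leqP => i _.
move=> i; apply/idP/idP => [Pi|].
  by rewrite (@leq_bigmax_cond _ P (fun j : 'I_N => j.+1)).
have [j Pj|P0] := pickP P; last by rewrite big1// => j; rewrite P0.
have [|k Pk ->] := @eq_bigmax_cond _ P (fun j : 'I_N => j.+1).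
  by apply/card_gt0P; exists j.
by move=> ik; exact: dP Pk.
Qed.

Section partial_sums.
Context (R : comNzRingType) (N : nat) (s : 'I_N -> R).

Definition partial_sum (k : nat) : R := \sum_(i < N | (i < k)%N) s i.

Lemma partial_sum0 : partial_sum 0 = 0.
Proof. by rewrite /partial_sum big_pred0. Qed.

Lemma partial_sum_full : partial_sum N = \sum_i s i.
Proof. by apply: eq_bigl => i; rewrite ltn_ord. Qed.

(** An initial segment has a partial sum as its total, and [g] of a partial sum telescopes. A
    nonlinear function of the vote share thus becomes linear in the indicators, and expectations can
    be taken term by term. *)
Lemma comp_sum_downward_closed (g : R -> R) (P : pred 'I_N) :
  (forall i j : 'I_N, (i <= j)%N -> P j -> P i) ->
  g (\sum_i s i * (P i)%:R) =
  g 0 + \sum_(i < N) (g (partial_sum i.+1) - g (partial_sum i)) * (P i)%:R.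
Proof.
move=> /downward_closed_ltn[k kN Pk].
transitivity (g (partial_sum k)).
  congr g; rewrite /partial_sum [RHS]big_mkcond; apply: eq_bigr => i _.
  by rewrite Pk; case: ifP; rewrite ?mulr1 ?mulr0.
rewrite [X in _ + X](_ : _ =
    \sum_(i < N | (i < k)%N) (g (partial_sum i.+1) - g (partial_sum i))).
  rewrite -(big_ord_widen N
    (fun i => g (partial_sum i.+1) - g (partial_sum i)) kN).
  rewrite -(big_mkord predT
    (fun i => g (partial_sum i.+1) - g (partial_sum i))).
  rewrite (telescope_sumr (fun i => g (partial_sum i)))//.
  by rewrite partial_sum0 addrC subrK.
rewrite [RHS]big_mkcond; apply: eq_bigr => i _.
by rewrite Pk; case: ifP; rewrite ?mulr1 ?mulr0.
Qed.

Lemma sum_comp_partial_sum (g : R -> R) :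
  \sum_(i < N) (g (partial_sum i.+1) - g (partial_sum i)) =
  g (\sum_i s i) - g 0.
Proof.
rewrite -(big_mkord predT
  (fun i => g (partial_sum i.+1) - g (partial_sum i))).
rewrite (telescope_sumr (fun i => g (partial_sum i)))//.
by rewrite partial_sum0 partial_sum_full.
Qed.

End partial_sums.

Lemma abel_sum (R : comNzRingType) (N : nat) (z : 'I_N.+1 -> R) (E : nat -> R) :
  E 0 = 0 -> E N.+1 = 0 ->
  \sum_(k < N.+1) z k * (E k - E k.+1) =
  \sum_(k < N) E k.+1 * (z (lift ord0 k) - z (widen_ord (leqnSn N) k)).
Proof.
move=> E0 EN; under eq_bigr do rewrite mulrBr.
rewrite sumrB big_ord_recl [X in _ - X]big_ord_recr/= E0 EN !mulr0 add0r addr0.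
rewrite -sumrB; apply: eq_bigr => k _.
by rewrite mulrBr ![E _ * _]mulrC.
Qed.

(** The squares of the [z i] cancel within each difference, which leaves an expression affine in
    [z i]; only the weighted mean survives. *)
Lemma weighted_sqr_dist (R : comNzRingType) (I : finType) (w z : I -> R) (x y : R) :
  \sum_i w i = 1 ->
  let L := \sum_i z i * w i in
  \sum_i w i * ((y - z i) ^+ 2 - (x - z i) ^+ 2) = (y - L) ^+ 2 - (x - L) ^+ 2.
Proof.
move=> w1 L.
rewrite (eq_bigr (fun i => (y ^+ 2 - x ^+ 2) * w i - 2 * (y - x) * (z i * w i))).
  by rewrite sumrB -!mulr_sumr w1 -/L; ring.
by move=> i _; ring.
Qed.

Lemma weighted_mean_itv (R : realDomainType) (I : finType) (w z : I -> R) (a b : R) :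
  (forall i, 0 <= w i) -> \sum_i w i = 1 -> (forall i, a <= z i <= b) ->
  \sum_i z i * w i \in `[a, b].
Proof.
move=> w0 w1 zab; rewrite in_itv/= -{1}[a]mulr1 -{1}[b]mulr1 -w1 !mulr_sumr.
by apply/andP; split; apply: ler_sum => i _; apply: ler_wpM2r => //;
  have /andP[] := zab i.
Qed.

(** Serves to compose a limit with the utility, which is continuous only relative to
    [[0, rhobar]]. *)
Lemma cvg_to_within (S T : Type) (F : set_system S) (H : set_system T)
    (A : set T) (h : S -> T) : Filter F ->
  h @ F --> H -> (\forall x \near F, A (h x)) -> h @ F --> within A H.
Proof.
by move=> FF hH hA P /hH; apply: filterS2 hA => x Ahx; exact.
Qed.

(** * Expectation of step functions under the uniform law *)

Section uniform_expectation.
Context (R : realType) (phi : R) (phiN : - phi < phi).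

Lemma indic_itvNyc (d x : R) : \1_`]-oo, d] x = (x <= d)%R%:R :> R.
Proof.
rewrite indicE; congr ((nat_of_bool _)%:R).
by apply/idP/idP; rewrite inE/= in_itv.
Qed.

Lemma uniform_prob_itvNy (d : R) : `|d| < phi ->
  uniform_prob phiN `]-oo, d] = ((d + phi) / (2 * phi))%:E.
Proof.
rewrite ltr_norml => /andP[d1 d2].
rewrite /uniform_prob integral_uniform_pdf.
(* As [d] lies strictly inside the support, the half-line meets it in [[- phi, d]], where the
   density is constant. *)
rewrite (_ : _ `&` _ = `[- phi, d]%classic); last first.
  apply/seteqP; split => x /=; rewrite !in_itv/=; first by case=> -> /andP[->].
  move=> /andP[-> xd]; split => //=; exact/ltW/(le_lt_trans xd).
rewrite (eq_integral (cst ((phi - - phi)^-1)%:E)); last first.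
  move=> x; rewrite inE/= in_itv/= /uniform_pdf => /andP[-> xd].
  by rewrite (ltW (le_lt_trans xd d2)).
rewrite integral_cst//= lebesgue_measure_itv/= lte_fin d1 -EFinD -EFinM.
congr EFin; rewrite mulrC opprK.
by congr (_ / _); ring.
Qed.

Lemma expectation_step (I : finType) (g0 : R) (w d : I -> R) :
  (forall i, `|d i| < phi) ->
  ('E_(uniform_prob phiN)[(fun eps => g0 + \sum_i w i * (eps <= d i)%R%:R)%R] =
  (g0 + \sum_i w i * ((d i + phi) / (2 * phi)))%R%:E)%E.
Proof.
move=> dphi; set P := uniform_prob phiN.
have iI i : P.-integrable setT (EFin \o (fun eps => (eps <= d i)%R%:R)).
  rewrite (_ : (fun eps => _) = \1_(`]-oo, d i]%classic)).
    exact: integrable_indic.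
  by apply/funext => e; rewrite indic_itvNyc.
rewrite unlock.
under eq_integral do rewrite EFinD -sumEFin.
rewrite integralD//=; last 2 first.
- exact: finite_measure_integrable_cst.
- apply: integrable_sum => // i _.
  under eq_fun do rewrite EFinM.
  exact: integrableZl (iI i).
rewrite integral_cst//.
rewrite [X in (_ * X + _)%E](@probability_setT _ _ _ (uniform_prob phiN)).
rewrite mule1 EFinD; congr (_ + _)%E.
rewrite integral_sum//=; last first.
  move=> i; under eq_fun do rewrite EFinM.
  exact: integrableZl (iI i).
rewrite -sumEFin; apply: eq_bigr => i _.
under eq_integral do rewrite EFinM.
rewrite integralZl//; last exact: iI.
rewrite EFinM; congr (_ * _)%E.
rewrite -uniform_prob_itvNy//.
transitivity (\int[uniform_prob phiN]_x (\1_(`]-oo, d i]%classic) x)%:E)%E.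
  by apply: eq_integral => e _; rewrite indic_itvNyc.
by rewrite integral_indic// setIT.
Qed.

End uniform_expectation.

(** * Cumulative shares, power rule and concavity of the utility *)

Section voting.
Context (R : realType) (n : nat) (G : platform_game R n).

Let c (k : nat) : R := partial_sum (share G) k.
Let z := bliss G.
Let rho := rhobar G.

Lemma bliss_le (i j : 'I_n.+2) : (i <= j)%N -> bliss G i <= bliss G j.
Proof.
rewrite leq_eqVlt => /orP[/eqP/val_inj->//|ij]; exact/ltW/bliss_lt.
Qed.

Lemma bliss_platforms i : bliss G i \in platforms G.
Proof. by rewrite in_itv/= !bliss_le// -ltnS. Qed.

Lemma partial_share_lt (j k : nat) : (j < k)%N -> (j < n.+2)%N -> c j < c k.
Proof.
move=> jk jn; rewrite /c /partial_sum.
rewrite [X in _ < X](bigID (fun i : 'I_n.+2 => (i < j)%N))/=.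
rewrite [X in _ < X + _](eq_bigl (fun i : 'I_n.+2 => (i < j)%N)); last first.
  by move=> i /=; apply: andb_idl => /ltn_trans; apply.
rewrite ltrDl (bigD1 (Ordinal jn))/=; last by rewrite jk ltnn.
by rewrite ltr_wpDr ?share_gt0// sumr_ge0// => i _; exact/ltW/share_gt0.
Qed.

Lemma partial_share_le (j k : nat) : (j <= k)%N -> (k <= n.+2)%N -> c j <= c k.
Proof.
rewrite leq_eqVlt => /orP[/eqP->//|jk kn].
by apply/ltW/partial_share_lt => //; exact: leq_trans jk kn.
Qed.

Lemma partial_share_full : c n.+2 = 1.
Proof. by rewrite /c partial_sum_full share_sum1. Qed.

Lemma partial_share_itv k : (k <= n.+2)%N -> 0 <= c k <= 1.
Proof.
move=> kn; rewrite -partial_share_full partial_share_le// andbT.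
by rewrite -(partial_sum0 (share G)) partial_share_le.
Qed.

Lemma partial_share_neq_half (m : 'I_n.+2) (k : nat) :
  c m < 2^-1 -> 2^-1 < c m.+1 -> (k <= n.+2)%N -> c k != 2^-1.
Proof.
move=> cm cm1 kn; have [km|mk] := leqP k m.
  by rewrite lt_eqF// (le_lt_trans (partial_share_le km _) cm)// ltnW.
by rewrite gt_eqF// (lt_le_trans cm1)// partial_share_le.
Qed.

Lemma utility_le u v : u \in `[0, rho] -> v \in `[0, rho] -> u <= v ->
  utility G u <= utility G v.
Proof.
move=> u0 v0; rewrite le_eqVlt => /orP[/eqP->//|uv].
by apply/ltW/utility_increasing.
Qed.

(** Both [q] and [rho - q] are convex combinations of [p] and [rho - p], with weights [t] and
    [1 - t] exchanged; adding the two strict concavity inequalities cancels [t]. *)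
Lemma utility_symmetric_sum_lt p q : 0 <= p -> p < q -> q <= rho / 2 ->
  utility G p + utility G (rho - p) < utility G q + utility G (rho - q).
Proof.
move=> p0 pq q2; have pp : rho - 2 * p != 0 by rewrite gt_eqF//; lra.
(* Solution of [t * p + (1 - t) * (rho - p) = q]. *)
pose t := (rho - p - q) / (rho - 2 * p).
have t01 : 0 < t < 1.
  by rewrite divr_gt0 ?ltr_pdivrMr ?mul1r; try lra.
have t01' : 0 < 1 - t < 1 by lra.
have pI : p \in `[0, rho] by rewrite in_itv/=; lra.
have pI' : rho - p \in `[0, rho] by rewrite in_itv/=; lra.
have pN : p != rho - p by rewrite lt_eqF//; lra.
have := utility_strictly_concave pI pI' pN t01.
have := utility_strictly_concave pI pI' pN t01'.
have -> : t * p + (1 - t) * (rho - p) = q by rewrite /t; field.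
have -> : (1 - t) * p + (1 - (1 - t)) * (rho - p) = rho - q by rewrite /t; field.
lra.
Qed.

Section power.
Variable r : R.
Hypothesis rI : r \in `[0, rho[.

Lemma power_rule0 : power_rule rho r 0 = 0.
Proof. by rewrite /power_rule invr_gt0 ltr0n mulr0. Qed.

Lemma power_rule1 : power_rule rho r 1 = rho.
Proof.
rewrite /power_rule ifF; last by apply/negbTE; rewrite -leNgt; lra.
by rewrite ifF; [ring|apply/negbTE; rewrite gt_eqF//; lra].
Qed.

Lemma power_rule_lt s : s < 2^-1 -> power_rule rho r s = (rho - r) * s.
Proof. by rewrite /power_rule => ->. Qed.

Lemma power_rule_gt s : 2^-1 < s -> power_rule rho r s = (rho - r) * s + r.
Proof. by move=> s2; rewrite /power_rule ltNge ltW//= gt_eqF. Qed.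

Lemma power_rule_half : power_rule rho r 2^-1 = rho / 2.
Proof. by rewrite /power_rule ltxx eqxx. Qed.

Lemma power_rule_le s t : s <= t -> power_rule rho r s <= power_rule rho r t.
Proof.
move: rI; rewrite in_itv/= => /andP[r0 r1] st.
rewrite /power_rule; case: (ltgtP s 2^-1) => s2; case: (ltgtP t 2^-1) => t2; nra.
Qed.

Lemma power_rule_itv s : 0 <= s <= 1 -> power_rule rho r s \in `[0, rho].
Proof.
move=> /andP[s0 s1].
rewrite in_itv/=; apply/andP; split.
  by apply: le_trans (power_rule_le s0); rewrite power_rule0.
by apply: (le_trans (power_rule_le s1)); rewrite power_rule1.
Qed.

Lemma share_utility_le s t : 0 <= s -> s <= t -> t <= 1 ->
  share_utility G r s <= share_utility G r t.
Proof.
by move=> s0 st t1; apply: utility_le; rewrite ?power_rule_itv ?power_rule_le//; lra.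
Qed.

Lemma share_utility_normalized :
  share_utility G r 1 - share_utility G r 0 = 1.
Proof. by rewrite /share_utility power_rule0 power_rule1 utility_normalized. Qed.

End power.

(** Summation by parts makes this the premium-dependent coefficient of a gap between neighbouring
    bliss points in the platform distance. *)
Definition coalition_utility (r s : R) : R :=
  share_utility G r s + share_utility G r (1 - s).

Lemma coalition_utility_sym r s :
  coalition_utility r (1 - s) = coalition_utility r s.
Proof. by rewrite /coalition_utility addrC subKr. Qed.

Lemma coalition_utility_lt r t s : r \in `[0, rho[ -> t \in `[0, rho[ ->
  r < t -> 0 < s < 1 -> s != 2^-1 ->
  coalition_utility t s < coalition_utility r s.
Proof.
rewrite !in_itv/= => rI tI rt s01 sN.
(* Exchanging [s] and [1 - s] preserves the sum, so [s] may be taken to be the minority share. *)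
wlog s2 : s s01 sN / s < 2^-1.
  move=> h; have [s2|s2|s2] := ltgtP s 2^-1; first exact: h.
    rewrite -(coalition_utility_sym t) -(coalition_utility_sym r).
    by apply: h; [lra|rewrite lt_eqF//; lra|lra].
  by rewrite s2 eqxx in sN.
have s2' : 2^-1 < 1 - s by lra.
rewrite /coalition_utility /share_utility.
rewrite !(power_rule_lt _ s2) !(power_rule_gt _ s2').
(* The powers of the two coalitions add up to [rho], and the minority power [(rho - u) * s] falls as
   the premium [u] grows. *)
have E u : (rho - u) * (1 - s) + u = rho - (rho - u) * s by ring.
rewrite !E.
by apply: utility_symmetric_sum_lt; nra.
Qed.

Lemma coalition_utility_le r t s : r \in `[0, rho[ -> t \in `[0, rho[ ->
  r <= t -> 0 < s < 1 -> coalition_utility t s <= coalition_utility r s.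
Proof.
move=> rI tI; rewrite le_eqVlt => /orP[/eqP->//|rt] s01.
have [->|s2] := eqVneq s 2^-1; last exact/ltW/coalition_utility_lt.
(* At a tie both powers are [rho / 2] whatever the premium, so equality holds. *)
rewrite /coalition_utility /share_utility (_ : 1 - 2^-1 = 2^-1) ?power_rule_half//.
by field.
Qed.

(** * Expected payoffs and equilibrium platforms *)

Lemma phi_gt0 : 0 < phi G.
Proof. by have := shock_itv G; rewrite -subr_gt0 opprK; lra. Qed.

(** When [a <= b], the supporters of A form an initial segment of types. Type [i] supports A with
    probability [1/2] plus its gap over [2 * phi]; the halves telescope to [(g 1 - g 0) / 2]. *)
Lemma expectation_vote_share (g : R -> R) (a b : R) :
  a \in platforms G -> b \in platforms G -> a <= b ->
  ('E_(shock_law G)[(fun eps => g (vote_shareA G a b eps))%R] =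
  (g 0 + (g 1 - g 0) / 2 +
   (\sum_(i < n.+2) (g (c i.+1) - g (c i)) * utility_gap (z i) a b) /
     (2 * phi G))%R%:E)%E.
Proof.
move=> aP bP ab.
rewrite (_ : (fun eps => _) = (fun eps => g 0 +
    \sum_(i < n.+2) (g (c i.+1) - g (c i)) *
      (eps <= utility_gap (z i) a b)%R%:R)); last first.
  apply/funext => eps; rewrite /vote_shareA /c.
  rewrite (@comp_sum_downward_closed _ _ _ g
    (fun i => eps <= utility_gap (z i) a b))// => i j ij /le_trans; apply.
  (* The gap is affine in the bliss point with slope [- 2 * (b - a)], hence nonincreasing. *)
  have := bliss_le ij; rewrite /utility_gap /z; nra.
rewrite expectation_step => [|i]; last exact: phi_gt_gap.
congr EFin; rewrite -addrA; congr (_ + _).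
have phi0 : phi G != 0 by rewrite gt_eqF// phi_gt0.
have <- : \sum_(i < n.+2) (g (c i.+1) - g (c i)) = g 1 - g 0.
  by rewrite sum_comp_partial_sum share_sum1.
rewrite !mulr_suml -big_split/=; apply: eq_bigr => i _.
by rewrite /z; field.
Qed.

Section equilibrium.
Variable r : R.
Hypothesis rI : r \in `[0, rho[.

Let nu := share_utility G r.

(** Since [c i] sums the shares of types strictly below [i], the cumulative share through [i] is
    [c i.+1], and the upper tail from [i] is [1 - c i]. *)
Definition lower_platform : R := \sum_(i < n.+2) z i * (nu (c i.+1) - nu (c i)).
Definition upper_platform : R :=
  \sum_(i < n.+2) z i * (nu (1 - c i) - nu (1 - c i.+1)).

Lemma lower_weight_ge0 (i : 'I_n.+2) : 0 <= nu (c i.+1) - nu (c i).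
Proof.
rewrite subr_ge0 share_utility_le ?partial_share_le//.
  by case/andP: (partial_share_itv (ltnW (ltn_ord i))).
by case/andP: (partial_share_itv (ltn_ord i)).
Qed.

Lemma upper_weight_ge0 (i : 'I_n.+2) : 0 <= nu (1 - c i) - nu (1 - c i.+1).
Proof.
have := partial_share_itv (ltnW (ltn_ord i)).
have := partial_share_itv (ltn_ord i) => /andP[_ c1] /andP[c0 _].
by rewrite subr_ge0 share_utility_le ?lerD2l ?lerN2 ?partial_share_le//; lra.
Qed.

Lemma lower_weight_sum1 : \sum_(i < n.+2) (nu (c i.+1) - nu (c i)) = 1.
Proof. by rewrite sum_comp_partial_sum share_sum1 share_utility_normalized. Qed.

Lemma upper_weight_sum1 : \sum_(i < n.+2) (nu (1 - c i) - nu (1 - c i.+1)) = 1.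
Proof.
apply: oppr_inj; rewrite -sumrN; under eq_bigr do rewrite opprB.
rewrite (sum_comp_partial_sum (share G) (fun s => nu (1 - s))) share_sum1.
by rewrite subrr subr0 -opprB share_utility_normalized.
Qed.

Lemma bliss_bounds (i : 'I_n.+2) : bliss G ord0 <= z i <= bliss G ord_max.
Proof. by have := bliss_platforms i; rewrite in_itv. Qed.

Lemma lower_platform_itv : lower_platform \in platforms G.
Proof.
exact: weighted_mean_itv lower_weight_ge0 lower_weight_sum1 bliss_bounds.
Qed.

Lemma upper_platform_itv : upper_platform \in platforms G.
Proof.
exact: weighted_mean_itv upper_weight_ge0 upper_weight_sum1 bliss_bounds.
Qed.

Lemma payoffA_left (a b : R) : a \in platforms G -> b \in platforms G -> a <= b ->
  payoffA G r a b = (nu 0 + 2^-1 +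
    ((b - lower_platform) ^+ 2 - (a - lower_platform) ^+ 2) / (2 * phi G))%:E.
Proof.
move=> aP bP ab; rewrite /payoffA (expectation_vote_share nu aP bP ab).
by rewrite /utility_gap weighted_sqr_dist ?lower_weight_sum1//
  share_utility_normalized// mul1r.
Qed.

Lemma payoffB_right (a b : R) : a \in platforms G -> b \in platforms G -> a <= b ->
  payoffB G r a b = (nu 1 - 2^-1 +
    ((a - upper_platform) ^+ 2 - (b - upper_platform) ^+ 2) / (2 * phi G))%:E.
Proof.
move=> aP bP ab; rewrite /payoffB.
(* The share of B is one minus that of A, so [g] is decreasing here: [g 1 - g 0 = -1], and the
   weights are the negated upper ones. *)
rewrite (expectation_vote_share (fun s => nu (1 - s)) aP bP ab).
rewrite subr0 subrr -(opprB (nu 1)) share_utility_normalized// mulN1r.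
congr (EFin (_ + _ / _)).
rewrite -(weighted_sqr_dist _ _ _ upper_weight_sum1).
by apply: eq_bigr => i _; rewrite /utility_gap; ring.
Qed.

(** Deviations that stay to the left of [b] suffice: among them the payoff decreases with the
    distance to [L]. *)
Lemma nash_left_platform (a b : R) : a < b -> nash_equilibrium G r a b ->
  a = lower_platform.
Proof.
move=> ab [aP bP bestA _]; set L := lower_platform.
have best x : x \in platforms G -> x <= b -> (a - L) ^+ 2 <= (x - L) ^+ 2.
  move=> xP xb; have := bestA x xP.
  rewrite (payoffA_left xP bP xb) (payoffA_left aP bP (ltW ab)) lee_fin lerD2l.
  by rewrite ler_pM2r ?invr_gt0 ?mulr_gt0 ?phi_gt0// lerD2l lerN2.
(* If [b < L], then [a < b < L] and moving to [b] is a profitable deviation; otherwise [L] itself is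
   an admissible deviation. *)
have [Lb|bL] := leP L b; last by have := best b bP (lexx b); nra.
have := best L lower_platform_itv Lb; rewrite subrr expr0n/= => h.
by apply/eqP; rewrite -subr_eq0 -sqrf_eq0 eq_le h sqr_ge0.
Qed.

Lemma nash_right_platform (a b : R) : a < b -> nash_equilibrium G r a b ->
  b = upper_platform.
Proof.
move=> ab [aP bP _ bestB]; set H := upper_platform.
have best x : x \in platforms G -> a <= x -> (b - H) ^+ 2 <= (x - H) ^+ 2.
  move=> xP ax; have := bestB x xP.
  rewrite (payoffB_right aP xP ax) (payoffB_right aP bP (ltW ab)) lee_fin lerD2l.
  by rewrite ler_pM2r ?invr_gt0 ?mulr_gt0 ?phi_gt0// lerD2l lerN2.
have [aH|Ha] := leP a H; last by have := best a aP (lexx a); nra.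
have := best H upper_platform_itv aH; rewrite subrr expr0n/= => h.
by apply/eqP; rewrite -subr_eq0 -sqrf_eq0 eq_le h sqr_ge0.
Qed.

Lemma equilibrium_platformsE (a b : R) : equilibrium_platforms G r a b ->
  a = lower_platform /\ b = upper_platform.
Proof.
by case=> ab eq; split; [exact: nash_left_platform eq|exact: nash_right_platform eq].
Qed.

End equilibrium.

(** * Monotonicity of the platform distance *)

Lemma polarization_diff (r t : R) : r \in `[0, rho[ -> t \in `[0, rho[ ->
  (upper_platform r - lower_platform r) - (upper_platform t - lower_platform t) =
  \sum_(k < n.+1) (coalition_utility r (c k.+1) - coalition_utility t (c k.+1)) *
    (z (lift ord0 k) - z (widen_ord (leqnSn n.+1) k)).
Proof.
move=> rI tI.
(* Comparing two premia makes the boundary terms vanish: at shares [0] and [1] the coalition utility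
   is [U(0) + U(rho)] for either premium. *)
pose E k := coalition_utility r (c k) - coalition_utility t (c k).
rewrite -(@abel_sum R n.+1 z E); first last.
- rewrite /E partial_share_full /coalition_utility subrr /share_utility.
  by rewrite !power_rule0 !power_rule1 subrr.
- rewrite /E /c partial_sum0 /coalition_utility subr0 /share_utility.
  by rewrite !power_rule0 !power_rule1 subrr.
rewrite /upper_platform /lower_platform -!sumrB; apply: eq_bigr => k _.
by rewrite /E /coalition_utility; ring.
Qed.

Lemma bliss_gap_gt0 (k : 'I_n.+1) :
  0 < z (lift ord0 k) - z (widen_ord (leqnSn n.+1) k).
Proof. by rewrite subr_gt0; apply: bliss_lt. Qed.

Lemma interior_share (k : 'I_n.+1) : 0 < c k.+1 < 1.
Proof.
rewrite -{1}(partial_sum0 (share G)) -partial_share_full.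
by rewrite !partial_share_lt// ltnS ltn_ord.
Qed.

Lemma polarization_le (r t : R) : r \in `[0, rho[ -> t \in `[0, rho[ -> r <= t ->
  upper_platform t - lower_platform t <= upper_platform r - lower_platform r.
Proof.
move=> rI tI rt; rewrite -subr_ge0 polarization_diff// sumr_ge0// => k _.
apply: mulr_ge0; last exact/ltW/bliss_gap_gt0.
by rewrite subr_ge0 coalition_utility_le// interior_share.
Qed.

(** * Strict decrease and limits with a strict median type *)

Section median.
Variable m : 'I_n.+2.
Hypotheses (cm_lt : c m < 2^-1) (cm1_gt : 2^-1 < c m.+1).

Lemma polarization_lt (r t : R) : r \in `[0, rho[ -> t \in `[0, rho[ -> r < t ->
  upper_platform t - lower_platform t < upper_platform r - lower_platform r.
Proof.
move=> rI tI rt; rewrite -subr_gt0 polarization_diff//.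
have term_gt0 (k : 'I_n.+1) : 0 <
    (coalition_utility r (c k.+1) - coalition_utility t (c k.+1)) *
    (z (lift ord0 k) - z (widen_ord (leqnSn n.+1) k)).
  apply: mulr_gt0; last exact: bliss_gap_gt0.
  rewrite subr_gt0 coalition_utility_lt// ?interior_share//.
  (* Cumulative shares jump over one half at [m], so none equals it and every term is strictly
     positive. *)
  by apply: partial_share_neq_half cm_lt cm1_gt _; rewrite ltnS ltnW.
rewrite (bigD1 ord0)//=; apply: ltr_wpDr; last exact: (term_gt0 ord0).
by apply: sumr_ge0 => k _; exact/ltW.
Qed.

Lemma share_utility_cvg_power s p : 0 <= s <= 1 -> p \in `[0, rho] ->
  power_rule rho r s @[r --> rho^'-] --> p ->
  share_utility G r s @[r --> rho^'-] --> utility G p.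
Proof.
move=> s01 pI cvg_p.
have /subspace_continuousP/(_ p pI) := @utility_continuous _ _ G.
apply: cvg_comp; apply: cvg_to_within => //.
near=> r; apply: power_rule_itv => //.
rewrite in_itv/=; apply/andP; split; near: r; last exact: nbhs_left_lt.
exact/nbhs_left_ge/rhobar_gt0.
Unshelve. all: by end_near. Qed.

Lemma premium_complement_cvg s : (rho - r) * s @[r --> rho^'-] --> (0 : R).
Proof.
have : (rho - r) * s @[r --> rho^'-] --> (rho - rho) * s.
  apply: cvgMr_tmp; apply: cvgB; first exact: cvg_cst.
  exact: cvg_at_left_filter cvg_id.
by rewrite subrr mul0r.
Qed.

Lemma share_utility_cvg_lt s : 0 <= s -> s < 2^-1 ->
  share_utility G r s @[r --> rho^'-] --> utility G 0.
Proof.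
move=> s0 s2; apply: share_utility_cvg_power; first by lra.
  by rewrite in_itv/= lexx/= ltW// rhobar_gt0.
under eq_cvg do rewrite power_rule_lt//.
exact: premium_complement_cvg.
Qed.

Lemma share_utility_cvg_gt s : 2^-1 < s -> s <= 1 ->
  share_utility G r s @[r --> rho^'-] --> utility G rho.
Proof.
move=> s2 s1; apply: share_utility_cvg_power; first by lra.
  by rewrite in_itv/= lexx andbT ltW// rhobar_gt0.
under eq_cvg do rewrite power_rule_gt//.
have cvg_rho : r @[r --> rho^'-] --> rho by exact: cvg_at_left_filter cvg_id.
have : (rho - r) * s + r @[r --> rho^'-] --> 0 + rho.
  by apply: cvgD cvg_rho; exact: premium_complement_cvg.
by rewrite add0r.
Qed.

(** The cumulative shares [c k] are below one half up to [k = m] and above it afterwards, so the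
    limiting power is all or nothing. *)
Lemma share_utility_cvg k : (k <= n.+2)%N ->
  share_utility G r (c k) @[r --> rho^'-] -->
  utility G (if (k <= m)%N then 0 else rho).
Proof.
move=> kn; have /andP[c0 c1] := partial_share_itv kn.
case: leqP => [km|mk].
  apply: share_utility_cvg_lt => //; apply: le_lt_trans cm_lt.
  by apply: partial_share_le => //; exact: ltnW.
apply: share_utility_cvg_gt => //; apply: lt_le_trans cm1_gt _.
exact: partial_share_le.
Qed.

Lemma share_utility_cvg_compl k : (k <= n.+2)%N ->
  share_utility G r (1 - c k) @[r --> rho^'-] -->
  utility G (if (k <= m)%N then rho else 0).
Proof.
move=> kn; have /andP[c0 c1] := partial_share_itv kn.
case: leqP => [km|mk].
  apply: share_utility_cvg_gt; last by lra.
  by have := le_lt_trans (partial_share_le km (ltnW (ltn_ord m))) cm_lt; lra.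
apply: share_utility_cvg_lt; first by lra.
by have := lt_le_trans cm1_gt (partial_share_le mk kn); lra.
Qed.

Lemma median_weighted_cvg (w : R -> 'I_n.+2 -> R) (l : 'I_n.+2 -> R) :
  (forall k, w r k @[r --> rho^'-] --> l k) ->
  (forall k, l k = (k == m)%:R) ->
  \sum_(k < n.+2) z k * w r k @[r --> rho^'-] --> z m.
Proof.
move=> wl lE; rewrite (_ : z m = \sum_(k < n.+2) z k * l k).
  apply: cvg_big; first exact: add_continuous.
  by move=> k _; apply: cvgMl_tmp; exact: wl.
rewrite (bigD1 m)//= big1 => [|k /negbTE km]; rewrite lE.
  by rewrite eqxx mulr1 addr0.
by rewrite km mulr0.
Qed.

Lemma lower_platform_cvg : lower_platform r @[r --> rho^'-] --> z m.
Proof.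
apply: (median_weighted_cvg (l := fun k =>
    utility G (if (k.+1 <= m)%N then 0 else rho) -
    utility G (if (k <= m)%N then 0 else rho))) => k.
  by apply: cvgB; apply: share_utility_cvg => //; exact: ltnW.
(* The limit values switch only between [m] and [m.+1], so type [m] gets weight [U(rho) - U(0) = 1]
   and the others get [0]. *)
case: (ltngtP k m) => [km|mk|/val_inj->]; rewrite ?subrr.
- by rewrite -val_eqE/= lt_eqF.
- by rewrite -val_eqE/= gt_eqF.
- by rewrite eqxx utility_normalized.
Qed.

Lemma upper_platform_cvg : upper_platform r @[r --> rho^'-] --> z m.
Proof.
apply: (median_weighted_cvg (l := fun k =>
    utility G (if (k <= m)%N then rho else 0) -
    utility G (if (k.+1 <= m)%N then rho else 0))) => k.
  by apply: cvgB; apply: share_utility_cvg_compl => //; exact: ltnW.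
case: (ltngtP k m) => [km|mk|/val_inj->]; rewrite ?subrr.
- by rewrite -val_eqE/= lt_eqF.
- by rewrite -val_eqE/= gt_eqF.
- by rewrite eqxx utility_normalized.
Qed.

End median.
End voting.

Theorem mainTheorem17 (R : realType) (n : nat) (G : platform_game R n)
    (xlo xhi : R -> R)
    (eqG : forall rm, rm \in `[0, rhobar G[ ->
      equilibrium_platforms G rm (xlo rm) (xhi rm)) :
  let D := fun rm => xhi rm - xlo rm in
  (forall r s, r \in `[0, rhobar G[ -> s \in `[0, rhobar G[ ->
    r <= s -> D s <= D r) /\
  (forall m : 'I_n.+2,
    \sum_(i < n.+2 | (i < m)%N) share G i < 2^-1 ->
    2^-1 < \sum_(i < n.+2 | (i <= m)%N) share G i ->
    [/\ forall r s, r \in `[0, rhobar G[ -> s \in `[0, rhobar G[ ->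
          r < s -> D s < D r,
        xlo rm @[rm --> (rhobar G)^'-] --> bliss G m,
        xhi rm @[rm --> (rhobar G)^'-] --> bliss G m
      & D rm @[rm --> (rhobar G)^'-] --> 0]).
Proof.
(* The given equilibrium platforms agree with the explicit formulas for premia in [[0, rhobar[], a
   set that contains all points near [rhobar] on its left; limits therefore transfer. *)
have eqE r (rI : r \in `[0, rhobar G[) := equilibrium_platformsE rI (eqG r rI).
have nearI : \forall r \near (rhobar G)^'-, r \in `[0, rhobar G[.
  near=> r; rewrite in_itv/=; apply/andP; split; near: r; last exact: nbhs_left_lt.
  exact/nbhs_left_ge/rhobar_gt0.
move=> D; split=> [r s rI sI rs|m cm cm1].
  rewrite /D; have [-> ->] := eqE _ rI; have [-> ->] := eqE _ sI.
  exact: polarization_le.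
have lo : xlo rm @[rm --> (rhobar G)^'-] --> bliss G m.
  apply: cvg_trans (lower_platform_cvg cm cm1); apply: near_eq_cvg.
  by apply: filterS nearI => r /eqE[].
have hi : xhi rm @[rm --> (rhobar G)^'-] --> bliss G m.
  apply: cvg_trans (upper_platform_cvg cm cm1); apply: near_eq_cvg.
  by apply: filterS nearI => r /eqE[].
split=> //; last by rewrite -(subrr (bliss G m)); exact: cvgB.
move=> r s rI sI rs; rewrite /D; have [-> ->] := eqE _ rI; have [-> ->] := eqE _ sI.
exact: polarization_lt cm cm1 _ _ _ _ _.
Unshelve. all: by end_near. Qed.
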